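(* Suppose that $\mathfrak{BP}(d,\underline{C};\underline{w})$ is $1$-feasible and $W^{min}>C_1$, and fix a positive integer $N$. If $$d\geq n\cdot N+n\cdot(n-1)\cdot w_1\cdot|\underline{w}|,$$ then there exists a $1$-feasible partition $\mathcal{B}_\bullet$ with $w(\mathcal{B}_1)=W^{min}$ and $n_1(\mathcal{B}_1)\geq N$.
   Context: Setting: integers $w_1\geq\cdots\geq w_n\geq0$, $|\underline{w}|=w_1+\cdots+w_n$, positive integer $d$, integers $C_1\geq\cdots\geq C_n$. $\mathcal{B}$ is the multiset with $d$ balls of weight $w_i$ for each $i$. A partition $\mathcal{B}_\bullet$ is $\mathcal{B}=\mathcal{B}_1\sqcup\cdots\sqcup\mathcal{B}_n$ with each $\mathcal{B}_i$ containing exactly $d$ balls; $w(\mathcal{B}_i)$ is its total weight and $n_1(\mathcal{B}_j)$ the number of balls of weight $w_1$ in $\mathcal{B}_j$. The partition is $1$-feasible if $w(\mathcal{B}_i)\leq C_i$ for $i=2,\dots,n$; $\mathfrak{BP}(d,\underline{C};\underline{w})$ is $1$-feasible if a $1$-feasible partition exists. $W^{min}$ is the minimum of $w(\mathcal{B}_1)$ over all $1$-feasible partitions. *)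

(* Defs.v *)
From mathcomp Require Import all_boot all_order all_algebra.
From mathcomp Require Import finmap multiset.

Set Implicit Arguments.
Unset Strict Implicit.
Unset Printing Implicit Defensive.

Local Open Scope mset_scope.
Local Open Scope nat_scope.

(* The number of boxes (and of entries of w and C) is n.+1, so that it is
   positive; the indices 1, 2, .. of the mathematical text are 0, 1, .. here.
   A ball is identified with its weight, so a collection of balls is a multiset
   of natural numbers. *)

Section BallPacking.

Variable n : nat.
Implicit Types (d : nat) (w : 'I_n.+1 -> nat) (C : 'I_n.+1 -> int).
Implicit Types (B : {mset nat}) (P : 'I_n.+1 -> {mset nat}).

Definition total_weight w : nat := \sum_(i < n.+1) w i.

(* Multiplicities add up when some of the w i coincide. *)
Definition balls d w : {mset nat} :=
  \big[@msetD nat/mset0]_(i < n.+1) msetn d (w i).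

Definition is_ball_partition d w P : Prop :=
  \big[@msetD nat/mset0]_(i < n.+1) P i = balls d w /\
  forall i, size (P i) = d.

(* Summation over a multiset takes multiplicities into account. *)
Definition weight B : nat := \sum_(x <- B) x.

Definition n1 w B : nat := B (w ord0).

Definition one_feasible_partition d C w P : Prop :=
  is_ball_partition d w P /\
  forall i : 'I_n.+1, i != ord0 -> ((weight (P i))%:Z <= C i)%R.

Definition one_feasible d C w : Prop := exists P, one_feasible_partition d C w P.

Definition is_Wmin d C w (Wmin : nat) : Prop :=
  (exists2 P, one_feasible_partition d C w P & weight (P ord0) = Wmin) /\
  forall P, one_feasible_partition d C w P -> Wmin <= weight (P ord0).

End BallPacking.

(* Main.v *)
(** Take a 1-feasible partition with w(B_1) = W^min. If B_1 has fewer than N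
    balls of weight w_1, some other box B_j has at least N + w_1 of them, as
    there are at least d such balls in all; moreover w(B_j) <= C_j <= C_1 <
    W^min = w(B_1). Pair the balls of B_1 with those of B_j: there are at least
    w_1 pairs in which B_j has a ball of weight w_1 and B_1 a lighter one, and
    the pairs in which B_1 has the heavier ball outweigh them. A pigeonhole
    argument on partial sums selects pairs of both kinds with total difference
    0. Swapping these keeps all box weights and increases n_1(B_1); iterate
    until n_1(B_1) >= N. *)

Require Import Defs.
From mathcomp Require Import all_boot all_order all_algebra.
From mathcomp Require Import finmap multiset zify.

Local Open Scope mset_scope.
Local Open Scope nat_scope.

(** * Blocks of equal sum in two sequences *)

Lemma sum_take (T : Type) (h : T -> nat) (s : seq T) (i j : nat) :
  i <= j ->
  sumn (map h (take j s)) =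
  sumn (map h (take i s)) + sumn (map h (take (j - i) (drop i s))).
Proof. by move=> ij; rewrite -{1}(subnKC ij) takeD map_cat sumn_cat. Qed.

(* For each k, let I k be the least i such that the first i values of f exceed
   the first k values of g in sum: the excess lies between 1 and K, so two of
   the K + 1 indices k = 0, .., K have the same excess. *)
Lemma equal_sum_blocks (T U : Type) (f : T -> nat) (g : U -> nat)
    (p : seq T) (q : seq U) (K : nat) :
  all (fun x => f x <= K) p -> sumn (map g q) < sumn (map f p) ->
  K <= size q ->
  exists p1 p2 p3 q1 q2 q3,
    [/\ p = p1 ++ p2 ++ p3, q = q1 ++ q2 ++ q3, 0 < size q2
      & sumn (map f p2) = sumn (map g q2)].
Proof.
move=> pK qp Kq.
pose F i := sumn (map f (take i p)); pose G k := sumn (map g (take k q)).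
have GF k : exists i, G k < F i.
  exists (size p); apply: leq_ltn_trans (_ : sumn (map g q) < _).
    by rewrite /G -[in leqRHS](cat_take_drop k q) map_cat sumn_cat leq_addr.
  by rewrite /F take_size.
pose I k := ex_minn (GF k); pose v k := F (I k) - G k.
have GFI k : G k < F (I k) by rewrite /I; case: ex_minnP.
have Imin k i : G k < F i -> I k <= i by rewrite /I; case: ex_minnP => m _; apply.
have stepF i : F i.+1 <= F i + K.
  rewrite /F; elim: p pK i {qp GF I v GFI Imin F} => [|x p IHp] //= /andP[xK pK] [|i] /=.
    by rewrite take0 addn0.
  by rewrite -addnA leq_add2l IHp.
have vK k : v k \in iota 1 K.
  rewrite mem_iota subn_gt0 GFI /= add1n ltnS leq_subLR addnC.
  (* [F 0 = 0] excludes [I k = 0]. Otherwise minimality gives [F i <= G k] at the predecessor [i],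
     and one more entry adds at most [K]. *)
  case Ik: (I k) => [|i]; first by have := GFI k; rewrite Ik /F take0.
  apply: leq_trans (stepF i) _; rewrite addnC leq_add2l leqNgt.
  by apply/negP => /Imin; rewrite Ik ltnn.
have /(uniqPn 0)[k [l [kl]]] : ~~ uniq (map v (iota 0 K.+1)).
  have sub : {subset map v (iota 0 K.+1) <= iota 1 K} by move=> _ /mapP[k _ ->].
  by apply/negP => /uniq_leq_size/(_ sub); rewrite size_map !size_iota ltnn.
rewrite size_map size_iota ltnS => lK.
have kK := leq_trans (ltnW kl) lK.
rewrite !(nth_map 0) ?size_iota ?ltnS // !nth_iota ?ltnS // !add0n => vkl.
have GG : G k <= G l by rewrite /G (sum_take _ _ _ _ _ (ltnW kl)) leq_addr.
have II : I k <= I l by apply: Imin; apply: leq_ltn_trans GG (GFI l).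
(* Equal excess at [k < l] means that [F] (along [I]) and [G] grow by the same amount in between;
   the middle blocks are these stretches. *)
exists (take (I k) p), (take (I l - I k) (drop (I k) p)),
  (drop (I l - I k) (drop (I k) p)).
exists (take k q), (take (l - k) (drop k q)), (drop (l - k) (drop k q)).
rewrite !cat_take_drop; split => //.
  (* Here [K <= size q] matters: it keeps [l] within [q], so the block has length [l - k > 0]. *)
  by rewrite size_take size_drop; case: ifP; lia.
have := sum_take _ f p _ _ II; have := sum_take _ g q _ _ (ltnW kl).
have := GFI k; have := GFI l; move: vkl; rewrite /v /F /G; lia.
Qed.

(** * Exchange of sublists of equal size and sum *)

Lemma perm_nseq_count (m : nat) (s : seq nat) :
  perm_eq s (nseq (count_mem m s) m ++ [seq x <- s | x != m]).
Proof.
have -> : nseq (count_mem m s) m = filter (pred1 m) s.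
  apply/esym; rewrite -size_filter; apply/all_pred1P.
  exact: filter_all.
by rewrite perm_sym; apply/permPl; apply: (perm_filterC (pred1 m)).
Qed.

(** Pairs whose second entry is at least the first only help; on the others the truncated difference
    is exact. *)
Lemma sumn_unzip_le (z : seq (nat * nat)) :
  sumn (unzip1 z) <=
  sumn (unzip2 z) + sumn [seq u.1 - u.2 | u <- z & u.2 < u.1].
Proof. by elim: z => //= u z IHz; case: ifP => /=; lia. Qed.

Lemma sumn_unzip_sub (z : seq (nat * nat)) :
  all (fun u => u.2 < u.1) z ->
  sumn (unzip1 z) = sumn (unzip2 z) + sumn [seq u.1 - u.2 | u <- z].
Proof. by elim: z => //= u z IHz /andP[? /IHz]; lia. Qed.

Lemma sumn_subl (m : nat) (s : seq nat) :
  all (geq m) s -> sumn s + sumn [seq m - x | x <- s] = size s * m.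
Proof. by elim: s => //= x s IHs /andP[? /IHs]; lia. Qed.

(* Cancel the common copies of m and pair off the remaining elements, so that
   the surplus copies of m in t face elements of s that are smaller than m. *)
Lemma balanced_exchange (m : nat) (s t : seq nat) :
  all (geq m) s -> size s = size t -> sumn t < sumn s ->
  count_mem m s + m <= count_mem m t ->
  exists S s0 T t0,
    [/\ perm_eq s (S ++ s0), perm_eq t (T ++ t0), size S = size T,
        sumn S = sumn T & count_mem m S < count_mem m T].
Proof.
move=> sm st ts cst.
have := perm_nseq_count m t; have := perm_nseq_count m s.
have : all (gtn m) [seq x <- s | x != m].
  apply/allP => x; rewrite mem_filter => /andP[xm /(allP sm)] /=; lia.
set c := count_mem m s in cst *; set e := count_mem m t in cst *.
set s' := filter _ s; set t' := filter _ t => s'm ps pt.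
clearbody c e s' t'.
have := perm_size ps; have := perm_size pt.
rewrite !size_cat !size_nseq st => -> /= sizes.
have := perm_sumn ps; have := perm_sumn pt.
rewrite !sumn_cat !sumn_nseq => sumt sums.
(* [k] is the surplus of copies of [m] in [t]: [s1] faces these copies, and [s2] faces the elements
   [t'] of [t] other than [m]. *)
pose k := e - c; pose s1 := take k s'; pose s2 := drop k s'.
have s12 : s' = s1 ++ s2 by rewrite cat_take_drop.
have size1 : size s1 = k by rewrite size_takel // /k; lia.
have size2 : size s2 = size t' by rewrite size_drop /k; lia.
pose z := zip s2 t'.
have z1 : unzip1 z = s2 by rewrite unzip1_zip ?size2.
have z2 : unzip2 z = t' by rewrite unzip2_zip ?size2.
have s1m : all (gtn m) s1 by move: s'm; rewrite s12 all_cat => /andP[].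
have s2m : all (gtn m) s2 by move: s'm; rewrite s12 all_cat => /andP[].
have zm : all (fun u => u.1 < m) z by rewrite -z1 all_map in s2m.
pose p := [seq u <- z | u.2 < u.1].
have pm : all (fun u => u.1 - u.2 <= m) p.
  apply/allP => u; rewrite mem_filter => /andP[_ /(allP zm)] /=; lia.
(* As [sumn t < sumn s], the signed differences over [z] exceed the total deficit of [s1] against
   [m]; dropping the negative ones cannot lower their sum. *)
have qp : sumn [seq m - x | x <- s1] < sumn [seq u.1 - u.2 | u <- p].
  have := sumn_unzip_le z; rewrite z1 z2 -/p.
  have := sumn_subl m s1; rewrite size1 (sub_all _ s1m); last by move=> x /ltnW.
  move=> /(_ isT); move: sums; rewrite s12 sumn_cat.
  have ek : e = c + k by lia.
  have := mulnDr m c k; rewrite -ek; lia.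
have km : m <= size s1 by lia.
have [p1 [p2 [p3 [q1 [q2 [q3 [ep eq q2gt0 pq]]]]]]] := equal_sum_blocks _ _ _ _ _ _ _ pm qp km.
pose r := p1 ++ p3 ++ [seq u <- z | ~~ (u.2 < u.1)].
have pz : perm_eq z (p2 ++ r).
  apply: perm_trans (_ : perm_eq (p ++ [seq u <- z | ~~ (u.2 < u.1)]) _).
    by rewrite perm_sym; apply/permPl; apply: (perm_filterC (fun u => u.2 < u.1)).
  by rewrite ep /r -!catA perm_catCA.
have p2lt : all (fun u => u.2 < u.1) p2.
  by have := filter_all (fun u => u.2 < u.1) z; rewrite -/p ep !all_cat => /and3P[].
have p2m : all (fun u => u.1 < m) p2.
  by move: zm; rewrite (perm_all _ pz) all_cat => /andP[].
have q2m : all (gtn m) q2 by move: s1m; rewrite eq !all_cat => /and3P[].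
have size12 : size s1 = size q1 + (size q2 + size q3) by rewrite eq !size_cat.
have q2e : size q2 <= e by apply: (@leq_trans k); [rewrite -size1 size12; clear; lia | exact: leq_subr].
(* The pairs in [p2] are swapped, and [q2] is traded for as many copies of [m]. All of [S] lies
   below [m], while [T] contains [m] because [q2] is nonempty. *)
exists (unzip1 p2 ++ q2), (nseq c m ++ q1 ++ q3 ++ unzip1 r).
exists (unzip2 p2 ++ nseq (size q2) m), (nseq (e - size q2) m ++ unzip2 r).
have count0 (x : seq nat) : all (gtn m) x -> count_mem m x = 0.
  by move=> xm; apply/count_memPn/negP => /(allP xm); rewrite /= ltnn.
split.
- have := perm_map fst pz; rewrite map_cat -/(unzip1 z) z1 => /permP c1.
  move/permP: ps => ps; apply/permP => a; move: (ps a) (c1 a).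
  by rewrite s12 eq /unzip1 !count_cat /=; clear; lia.
- have := perm_map snd pz; rewrite map_cat -/(unzip2 z) z2 => /permP c2.
  move/permP: pt => pt; apply/permP => a; move: (pt a) (c2 a).
  by rewrite /unzip2 !count_cat !count_nseq /=; case: (a m); clear -q2e; lia.
- by rewrite !size_cat !size_map size_nseq.
- rewrite !sumn_cat sumn_nseq (sumn_unzip_sub _ p2lt) pq.
  have := sumn_subl m q2; rewrite (sub_all _ q2m); last by move=> x /ltnW.
  by move=> /(_ isT); clear; lia.
- rewrite !count_cat count0 1?count0 //; last by rewrite all_map.
  by rewrite count_nseq /= eqxx; clear -q2gt0; lia.
Qed.

(** * Exchange between boxes of a ball partition *)

Lemma big_msetDE (n : nat) (X : 'I_n.+1 -> {mset nat}) (a : nat) :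
  (\big[@msetD nat/mset0]_(i < n.+1) X i) a = \sum_(i < n.+1) X i a.
Proof.
apply: (big_morph (fun B : {mset nat} => B a)); last exact: mset0E.
by move=> A B; rewrite msetE2.
Qed.

Lemma mem_balls_le (n d : nat) (w : 'I_n.+1 -> nat)
    (w_noninc : forall i j : 'I_n.+1, i <= j -> w j <= w i)
    (x : nat) :
  x \in balls d w -> x <= w ord0.
Proof.
rewrite in_mset big_msetDE lt0n sum_nat_eq0 => /forallPn[i].
rewrite msetnE /=; case: (eqVneq x) => // -> _; exact: w_noninc.
Qed.

Lemma balls_w0 (n d : nat) (w : 'I_n.+1 -> nat) : d <= balls d w (w ord0).
Proof. by rewrite big_msetDE big_ord_recl msetnxx leq_addr. Qed.

Lemma partition_le (n d : nat) (w : 'I_n.+1 -> nat)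
    (w_noninc : forall i j : 'I_n.+1, i <= j -> w j <= w i)
    (P : 'I_n.+1 -> {mset nat}) (i : 'I_n.+1) :
  is_ball_partition d w P -> all (geq (w ord0)) (P i).
Proof.
move=> [Pw _]; apply/allP => x xP; apply: (@mem_balls_le _ d _ w_noninc).
rewrite -Pw in_mset big_msetDE (bigD1 i) //= addn_gt0; apply/orP; left.
by rewrite -in_mset.
Qed.

Lemma weightE (B : {mset nat}) : weight B = sumn B.
Proof. by rewrite sumnE. Qed.

Lemma partition_exchange (n d : nat) (w : 'I_n.+1 -> nat)
    (w_noninc : forall i j : 'I_n.+1, i <= j -> w j <= w i)
    (P : 'I_n.+1 -> {mset nat}) (j : 'I_n.+1) :
  is_ball_partition d w P -> j != ord0 -> weight (P j) < weight (P ord0) ->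
  n1 w (P ord0) + w ord0 <= n1 w (P j) ->
  exists P',
    [/\ is_ball_partition d w P', forall i, weight (P' i) = weight (P i)
      & n1 w (P ord0) < n1 w (P' ord0)].
Proof.
move=> Pw j0; rewrite !weightE /n1 -!count_mem_mset => wlt nle.
have [Psum Psize] := Pw.
have szP : size (P ord0) = size (P j) by rewrite !Psize.
have [S [s0 [T [t0 [ps pt sizeST sumST countST]]]]] :=
  balanced_exchange _ _ _ (partition_le _ _ _ w_noninc P ord0 Pw) szP wlt nle.
(* Box [ord0] gives [S] to box [j] and receives [T]; equal sizes and sums preserve all box sizes and
   weights. *)
pose P' i := if i == ord0 then seq_mset (T ++ s0)
             else if i == j then seq_mset (S ++ t0) else P i.
have P'0 : P' ord0 = seq_mset (T ++ s0) by [].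
have P'j : P' j = seq_mset (S ++ t0) by rewrite /P' (negPf j0) eqxx.
have P'i i : i != ord0 -> i != j -> P' i = P i.
  by rewrite /P' => /negPf-> /negPf->.
have P'cases (i : 'I_n.+1) : [\/ i = ord0, i = j | i != ord0 /\ i != j].
  case: (eqVneq i ord0) => [?|i0]; first by constructor 1.
  by case: (eqVneq i j) => [?|?]; [constructor 2 | constructor 3].
exists P'; split; last 1 first.
- have /permP/(_ (pred1 (w ord0))) := perm_eq_seq_mset (T ++ s0).
  rewrite P'0 -[X in _ < X]count_mem_mset => ->.
  move/permP/(_ (pred1 (w ord0))): ps => ->.
  by rewrite !count_cat ltn_add2r.
- split.
    rewrite -Psum; apply/msetP => a; rewrite !big_msetDE.
    rewrite (bigD1 ord0) // (bigD1 j) //= [RHS](bigD1 ord0) // [in RHS](bigD1 j) //=.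
    rewrite P'0 P'j !mset_seqE -!(count_mem_mset a (P _)).
    move/permP/(_ (pred1 a)): ps => ->; move/permP/(_ (pred1 a)): pt => ->.
    rewrite !addnA; congr (_ + _); first by rewrite !count_cat addnACA [RHS]addnACA (addnC (count _ T)).
    by apply: eq_bigr => i /andP[i0 ij]; rewrite P'i.
  move=> i; case: (P'cases i) => [->|->|[i0 ij]]; last by rewrite P'i.
  - rewrite P'0 (perm_size (perm_eq_seq_mset _)) -(Psize ord0) (perm_size ps).
    by rewrite !size_cat sizeST.
  - rewrite P'j (perm_size (perm_eq_seq_mset _)) -(Psize j) (perm_size pt).
    by rewrite !size_cat sizeST.
- move=> i; rewrite !weightE.
  case: (P'cases i) => [->|->|[i0 ij]]; last by rewrite P'i.
  - by rewrite P'0 (perm_sumn (perm_eq_seq_mset _)) (perm_sumn ps) !sumn_cat sumST.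
  - by rewrite P'j (perm_sumn (perm_eq_seq_mset _)) (perm_sumn pt) !sumn_cat sumST.
Qed.

(** Otherwise the balls of weight [w ord0] number less than [N] in box [ord0] and less than
    [N + w ord0] in each of the [n] others, so fewer than [d] in all, against [balls_w0]. *)
Lemma exists_box_many_w0 (n d : nat) (w : 'I_n.+1 -> nat)
    (P : 'I_n.+1 -> {mset nat}) (N : nat) :
  is_ball_partition d w P -> n1 w (P ord0) < N ->
  n.+1 * N + n * w ord0 <= d ->
  exists2 j, j != ord0 & N + w ord0 <= n1 w (P j).
Proof.
move=> [Psum _] n1N dN; apply/exists_inP; apply: contraT.
rewrite negb_exists_in => /forall_inP small.
have : d <= \sum_(i < n.+1) n1 w (P i).
  by rewrite -big_msetDE Psum balls_w0.
apply: contraLR => _; rewrite -ltnNge big_ord_recl.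
(* Box [ord0] supplies the strictness, so weak bounds suffice for the other boxes, even when
   [n = 0]. *)
apply: leq_trans dN; rewrite mulSn -addnA -mulnDr -addSn leq_add //.
apply: (@leq_trans (\sum_(i < n) (N + w ord0))).
  by apply: leq_sum => i _; apply: ltnW; rewrite ltnNge; exact: small.
by rewrite sum_nat_const card_ord.
Qed.

Theorem theorem3p1 (n d : nat) (w : 'I_n.+1 -> nat) (C : 'I_n.+1 -> int)
    (Wmin N : nat)
    (w_noninc : forall i j : 'I_n.+1, i <= j -> w j <= w i)
    (C_noninc : forall i j : 'I_n.+1, i <= j -> (C j <= C i)%R)
    (d_gt0 : 0 < d)
    (feas : one_feasible d C w)
    (Wmin_def : is_Wmin d C w Wmin)
    (Wmin_gt : (C ord0 < Wmin%:Z)%R)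
    (N_gt0 : 0 < N)
    (d_large : n.+1 * N + n.+1 * n * w ord0 * total_weight w <= d) :
  exists P : 'I_n.+1 -> {mset nat},
    [/\ one_feasible_partition d C w P,
        weight (P ord0) = Wmin
      & N <= n1 w (P ord0)].
Proof.
have [[P0 P0feas P0W] _] := Wmin_def.
have w0_total : w ord0 <= total_weight w by rewrite /total_weight big_ord_recl leq_addr.
have dN : n.+1 * N + n * w ord0 <= d.
  apply: leq_trans d_large; rewrite leq_add2l.
  case: (posnP (w ord0)) => [->|w0]; first by rewrite muln0.
  have W0 := leq_trans w0 w0_total.
  apply: leq_trans (leq_pmulr _ W0).
  by rewrite leq_mul2r mulSn leq_addr orbT.
(* An exchange is only known to gain at least one ball of weight [w ord0], hence the induction on
   [k]; it fixes all weights, so feasibility and [Wmin] persist. *)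
suff step k : k <= N -> exists P : 'I_n.+1 -> {mset nat},
    [/\ one_feasible_partition d C w P, weight (P ord0) = Wmin
      & k <= n1 w (P ord0)] by exact: step (leqnn N).
elim: k => [|k IHk] kN; first by exists P0.
have [P [Pfeas PW kP]] := IHk (ltnW kN).
case: (ltnP k (n1 w (P ord0))) => [kltP|Pk]; first by exists P.
have [Ppart PC] := Pfeas.
have [j j0 Nj] := exists_box_many_w0 _ _ _ _ _ Ppart (leq_ltn_trans Pk kN) dN.
have wlt : weight (P j) < weight (P ord0).
  have := PC j j0; have := C_noninc ord0 j (leq0n j); rewrite PW; lia.
have [|P' [P'part P'W P'n]] := partition_exchange _ _ _ w_noninc _ _ Ppart j0 wlt.
  by apply: leq_trans Nj; rewrite leq_add2r (leq_trans Pk (ltnW kN)).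
exists P'; split; last exact: leq_ltn_trans kP P'n.
  by split=> // i i0; rewrite P'W PC.
by rewrite P'W.
Qed.
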